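(* For every integer $n\ge0$, the following polynomial identities hold: (1) $\displaystyle \mathrm B_{n+1}(x,y)=\sum_{k=0}^n\binom nk\mathrm B_k(x)\,y^{n-k}=\sum_{k=0}^n\binom nk\mathrm{Fe}_k(x)(y+1)^{n-k}$; (2) $\displaystyle \mathrm C_{n+1}(x,y)=\sum_{k=0}^n\binom nk\mathrm{Mo}_k(x)\,y^{n-k}=\sum_{k=0}^{\lfloor n/2\rfloor}\mathcal C_k\binom n{2k}x^k(y+1)^{n-2k}$, where $\mathcal C_k=\frac1{k+1}\binom{2k}k$.
   Context: A set partition of $[n]=\{1,\dots,n\}$ is a set of nonempty pairwise disjoint sets (blocks) with union $[n]$ ($[0]=\emptyset$ has exactly one partition, the empty one). A pair $(i,j)$ is an arc of $\Lambda$ if $i<j$ lie in the same block and $j$ is the least element of that block greater than $i$; $\mathrm{Arc}(\Lambda)$ is the set of arcs and $\mathrm{Cov}(\Lambda)=\{(i,j)\in\mathrm{Arc}(\Lambda):j=i+1\}$. $\Lambda$ is noncrossing if there are no arcs $(i,k),(j,l)$ with $i<j<k<l$; feasible if every block has at least two elements; poor if every block has at most two elements. $\Pi(n)$ and $\mathrm{NC}(n)$ are the sets of partitions and noncrossing partitions of $[n]$. Define $\mathrm B_n(x,y)=\sum_{\Lambda\in\Pi(n)}x^{|\mathrm{Arc}(\Lambda)\setminus\mathrm{Cov}(\Lambda)|}y^{|\mathrm{Cov}(\Lambda)|}$, $\mathrm C_n(x,y)$ the same sum over $\mathrm{NC}(n)$, $\mathrm B_n(x)=\mathrm B_n(x,x)$,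 $\mathrm{Fe}_n(x)=\sum_{\text{feasible }\Lambda\in\Pi(n)}x^{|\mathrm{Arc}(\Lambda)|}$ and $\mathrm{Mo}_n(x)=\sum_{\text{poor }\Lambda\in\mathrm{NC}(n)}x^{|\mathrm{Arc}(\Lambda)|}$. *)

(* Defs.v *)
(* Elements of [n] = {1..n} are encoded as 'I_n (i <-> i+1). *)
From mathcomp Require Import all_boot all_order all_algebra.
Set Implicit Arguments. Unset Strict Implicit. Unset Printing Implicit Defensive.
Import GRing.Theory.
Local Open Scope ring_scope.

Definition set_partition (n : nat) (P : {set {set 'I_n}}) : bool :=
  partition P [set: 'I_n].

Definition is_arc (n : nat) (P : {set {set 'I_n}}) (i j : 'I_n) : bool :=
  [exists B in P, [&& i \in B, j \in B, (i < j)%N &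
     [forall k in B, ~~ ((i < k)%N && (k < j)%N)]]].

Definition Arc (n : nat) (P : {set {set 'I_n}}) : {set 'I_n * 'I_n} :=
  [set p | is_arc P p.1 p.2].

Definition Cov (n : nat) (P : {set {set 'I_n}}) : {set 'I_n * 'I_n} :=
  [set p in Arc P | nat_of_ord p.2 == (nat_of_ord p.1).+1].

Definition noncrossing (n : nat) (P : {set {set 'I_n}}) : bool :=
  [forall a in Arc P, forall b in Arc P,
     ~~ [&& (a.1 < b.1)%N, (b.1 < a.2)%N & (a.2 < b.2)%N]].

Definition feasible (n : nat) (P : {set {set 'I_n}}) : bool :=
  [forall B in P, 2 <= #|B|]%N.

Definition poor (n : nat) (P : {set {set 'I_n}}) : bool :=
  [forall B in P, #|B| <= 2]%N.

Section Polys.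
Variable R : comPzRingType.

Definition Bxy (n : nat) (x y : R) : R :=
  \sum_(P : {set {set 'I_n}} | set_partition P)
    x ^+ #|Arc P :\: Cov P| * y ^+ #|Cov P|.

Definition Cxy (n : nat) (x y : R) : R :=
  \sum_(P : {set {set 'I_n}} | set_partition P && noncrossing P)
    x ^+ #|Arc P :\: Cov P| * y ^+ #|Cov P|.

Definition Bx (n : nat) (x : R) : R := Bxy n x x.

Definition Fe (n : nat) (x : R) : R :=
  \sum_(P : {set {set 'I_n}} | set_partition P && feasible P) x ^+ #|Arc P|.

Definition Mo (n : nat) (x : R) : R :=
  \sum_(P : {set {set 'I_n}} | [&& set_partition P, noncrossing P & poor P])
    x ^+ #|Arc P|.
End Polys.

(* Catalan number C_k = binom(2k,k)/(k+1) (an exact division in nat) *)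
Definition catalan (k : nat) : nat := 'C(k.*2, k) %/ k.+1.

(* Main.v *)
(* A set partition of [n+1] is determined by its arcs, that is by a placement of
   nonattacking rooks (i, j) with i < j. Replacing j by j - 1 gives a placement
   of rooks i <= j on [n] whose diagonal rooks are the covers. Deleting the rows
   and columns of the diagonal rooks leaves a strict placement, i.e. a partition,
   of the remaining points; the noncrossing condition becomes the condition that
   this partition be noncrossing and poor. This gives the first formulas.
   Choosing next the points that lie on some arc expresses the strict placements
   through the feasible ones, and the binomial theorem turns y into y + 1. Finally
   the feasible poor noncrossing partitions are the noncrossing perfect matchings,
   counted by peeling off the last point: it is either open or closes the last
   open point, which is the ballot recurrence. *)
Require Import Defs.
From mathcomp Require Import all_boot all_order all_algebra zify ring.
Set Implicit Arguments. Unset Strict Implicit. Unset Printing Implicit Defensive.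
Import GRing.Theory.
Local Open Scope ring_scope.

(** * Arc sets as placements of nonattacking rooks *)

Definition strict n (A : {set 'I_n * 'I_n}) := [forall a in A, (a.1 < a.2)%N].
Definition weak n (A : {set 'I_n * 'I_n}) := [forall a in A, (a.1 <= a.2)%N].

(* For [c = true] the inequality in the middle is weak, so two arcs sharing an
   inner endpoint are excluded as well: on strict arc sets this means
   noncrossing and poor. *)
Definition compat_rel (c : bool) n (a b : 'I_n * 'I_n) :=
  ((a.1 == b.1) || (a.2 == b.2) ==> (a == b)) &&
  (c ==> ~~ [&& a.1 < b.1, b.1 <= a.2 & a.2 < b.2]%N).

Definition compat c n (A : {set 'I_n * 'I_n}) :=
  [forall a in A, forall b in A, compat_rel c a b].

Lemma strictP n (A : {set 'I_n * 'I_n}) :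
  reflect (forall a, a \in A -> (a.1 < a.2)%N) (strict A).
Proof. exact: forall_inP. Qed.

Lemma weakP n (A : {set 'I_n * 'I_n}) :
  reflect (forall a, a \in A -> (a.1 <= a.2)%N) (weak A).
Proof. exact: forall_inP. Qed.

Lemma compatP c n (A : {set 'I_n * 'I_n}) :
  reflect (forall a b, a \in A -> b \in A -> compat_rel c a b) (compat c A).
Proof.
apply: (iffP forall_inP) => [H a b aA bA|H a aA]; first exact: (forall_inP (H a aA)).
by apply/forall_inP => b bA; apply: H.
Qed.

(** The paths of a partial function cannot branch: of two paths from the same point, the shorter is
    an initial segment of the longer. *)
Lemma det_connect_comparable (T : finType) (e : rel T) :
    (forall i j k, e i j -> e i k -> j = k) ->
  forall i j k, connect e i j -> connect e i k -> connect e j k || connect e k j.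
Proof.
move=> det i j k /connectP[p]; elim: p i => [|a p IH] i /= => [_ -> -> //|].
case/andP=> eia pa lj ik; case/connectP: (ik) => [[|b q]] /= => [_ ek|].
  apply/orP; right; rewrite ek; apply: connect_trans (connect1 eia) _.
  by apply/connectP; exists p.
case/andP=> eib pb lk; apply: (IH a) => //; rewrite (det _ _ _ eia eib).
by apply/connectP; exists q.
Qed.

(** * From arc sets to set partitions *)

Section ArcsToBlocks.
Variables (n : nat) (A : {set 'I_n * 'I_n}).
Hypotheses (sA : strict A) (cA : compat false A).

Let e : rel 'I_n := fun i j => (i, j) \in A.

(** In a compatible arc set each point has at most one arc leaving it and at most one entering it,
    so reachability in either direction is already an equivalence. *)
Definition linked (i j : 'I_n) := connect (fun k l => (k, l) \in A) i j ||
  connect (fun k l => (k, l) \in A) j i.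

Lemma connect_arcs_le i j : connect e i j -> (i <= j)%N.
Proof.
case/connectP=> p; elim: p i => [|a p IH] i /= => [_ -> //|/andP[eia pa] lj].
by apply: leq_trans (IH _ pa lj); apply: ltnW; apply: (strictP _ sA _ eia).
Qed.

Lemma arcs_det i j k : e i j -> e i k -> j = k.
Proof.
move=> ij ik; have := compatP _ _ cA _ _ ij ik.
by rewrite /compat_rel /= eqxx andbT => /eqP[].
Qed.

Lemma arcs_codet i j k : e j i -> e k i -> j = k.
Proof.
move=> ij ik; have := compatP _ _ cA _ _ ij ik.
by rewrite /compat_rel /= eqxx orbT andbT => /eqP[].
Qed.

(** Reversing all arcs again gives a partial function, by [arcs_codet]. *)
Lemma connect_arcs_down i j k :
  connect e j i -> connect e k i -> connect e j k || connect e k j.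
Proof.
have rev x y : connect (fun x y => e y x) x y = connect e y x := connect_rev e x y.
rewrite -!rev orbC; apply: det_connect_comparable => x y z; exact: arcs_codet.
Qed.

Lemma linked_equiv : {in [set: 'I_n] & &, equivalence_rel linked}.
Proof.
have symL : symmetric linked by move=> i j; rewrite /linked orbC.
have trL : transitive linked.
  (* Paths in the same direction compose; two paths into [j], or two paths out of [j], are
     nested. *)
  move=> j i k /orP[ij|ji] /orP[jk|kj]; rewrite /linked.
  - by rewrite (connect_trans ij jk).
  - exact: connect_arcs_down ij kj.
  - exact: det_connect_comparable arcs_det _ _ _ ji jk.
  - by rewrite (connect_trans kj ji) orbT.
move=> i j k _ _ _; split; first by rewrite /linked connect0.
by move=> ij; apply/idP/idP; apply: trL => //; rewrite symL.
Qed.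

End ArcsToBlocks.

Definition blocks n (A : {set 'I_n * 'I_n}) : {set {set 'I_n}} :=
  equivalence_partition (linked A) [set: 'I_n].

Lemma blocks_partition n (A : {set 'I_n * 'I_n}) :
  compat false A -> set_partition (blocks A).
Proof. by move=> cA; apply/equivalence_partitionP/linked_equiv. Qed.

Lemma is_arcE n (P : {set {set 'I_n}}) i j : set_partition P ->
  is_arc P i j = [&& j \in pblock P i, (i < j)%N &
    [forall k in pblock P i, ~~ ((i < k)%N && (k < j)%N)]].
Proof.
case/and3P=> /eqP cP tP P0; have iP : i \in cover P by rewrite cP inE.
apply/exists_inP/idP => [[B BP /and4P[iB jB ij H]]|H].
  by rewrite (def_pblock tP BP iB) jB ij.
by exists (pblock P i); rewrite ?pblock_mem // mem_pblock iP.
Qed.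

(** A path from [i] to a later point of its block starts with the unique arc leaving [i], and paths
    only increase, so the head of that arc is the next element of the block. *)
Lemma blocksK n (A : {set 'I_n * 'I_n}) :
  strict A -> compat false A -> Arc (blocks A) = A.
Proof.
move=> sA cA; apply/setP=> -[i j]; rewrite inE /= is_arcE ?blocks_partition //.
have pbE k l : (l \in pblock (blocks A) k) = linked A k l.
  by rewrite (pblock_equivalence_partition (linked_equiv cA)) ?inE.
have up (k l : 'I_n) : (k < l)%N -> linked A k l ->
    exists2 m, (k, m) \in A & connect (fun k l => (k, l) \in A) m l.
  move=> kl /orP[|/(connect_arcs_le sA)]; last by rewrite leqNgt kl.
  case/connectP=> [[|m p]] /= => [_ E|/andP[km pm] El]; first by rewrite E ltnn in kl.
  by exists m => //; apply/connectP; exists p.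
rewrite pbE; apply/and3P/idP=> [[lij ij /forall_inP H]|Aij].
  have [m im mj] := up _ _ ij lij.
  have := connect_arcs_le sA mj; rewrite leq_eqVlt => /predU1P[/val_inj <- //|mj'].
  have := H m; rewrite pbE /linked connect1 // mj' andbT => /(_ isT).
  by rewrite (strictP _ sA _ im).
split; first by rewrite /linked connect1.
  exact: (strictP _ sA _ Aij).
apply/forall_inP=> k; rewrite pbE => lik; apply/negP=> /andP[ik kj].
have [m im mk] := up _ _ ik lik; have := connect_arcs_le sA mk.
by rewrite -(arcs_det cA Aij im) leqNgt kj.
Qed.

(** * From set partitions to arc sets *)

Section BlocksToArcs.
Variables (n : nat) (P : {set {set 'I_n}}).
Hypothesis pP : set_partition P.

Lemma mem_pblock_sym i j : (j \in pblock P i) = (i \in pblock P j).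
Proof.
by case/and3P: pP => /eqP cP tP _; rewrite -!eq_pblock ?cP ?inE // eq_sym.
Qed.

Lemma mem_pblock_trans i j k :
  j \in pblock P i -> k \in pblock P j -> k \in pblock P i.
Proof. by case/and3P: pP => /eqP cP tP _ /(same_pblock tP) ->. Qed.

Lemma strict_Arc : strict (Arc P).
Proof. by apply/strictP=> -[i j]; rewrite inE is_arcE //= => /and3P[]. Qed.

(** The right end of an arc is the successor of the left end within their block, so either end
    determines the other. *)
Lemma compat_Arc : compat false (Arc P).
Proof.
apply/compatP=> -[i j] [k l]; rewrite !inE !is_arcE //= /compat_rel andbT /=.
case/and3P=> ji ij /forall_inP Hij /and3P[lk kl /forall_inP Hkl].
apply/implyP=> /orP[]/eqP E; move: E lk kl Hkl => <- => lk kl Hkl.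
  apply/eqP; congr pair; apply: val_inj; apply/eqP.
  have := Hij l lk; have := Hkl j ji; rewrite ij kl /= -!leqNgt => H1 H2.
  by rewrite eqn_leq H1 H2.
have ki : k \in pblock P i by apply: mem_pblock_trans ji _; rewrite mem_pblock_sym.
apply/eqP; congr pair; apply: val_inj; apply/eqP.
have := Hij k ki; have := Hkl i; rewrite mem_pblock_sym ki => /(_ isT).
rewrite ij kl !andbT -!leqNgt => H1 H2.
by rewrite eqn_leq H1 H2.
Qed.

Lemma connect_Arc (i j : 'I_n) : (i <= j)%N ->
  connect (fun k l => (k, l) \in Arc P) i j = (j \in pblock P i).
Proof.
move=> ij; apply/idP/idP=> [/connectP[p]|].
  elim: p i {ij} => [|a p IH] i /= => [_ ->|/andP[+ pa] lj].
    by case/and3P: pP => /eqP cP _ _; rewrite mem_pblock cP inE.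
  rewrite inE is_arcE //= => /and3P[ai _ _]; exact: mem_pblock_trans ai (IH _ pa lj).
have [m] := ubnP (j - i); elim: m i ij => // m IH i.
rewrite leq_eqVlt => /predU1P[/val_inj -> //|ij] jim ji.
(* An arc from [i] that does not overshoot [j] reduces the distance. Such an arc exists: it leads to
   the least block element above [i], which is at most [j]. *)
have [/existsP[k /and3P[ki ik kj]]|H] :=
  boolP [exists k, [&& k \in pblock P i, (i < k)%N & (k <= j)%N && ((i, k) \in Arc P)]].
  case/andP: kj => kj aik; apply: connect_trans (connect1 aik) _.
  apply: IH => //; first by lia.
  by apply: mem_pblock_trans ji; rewrite mem_pblock_sym.
have ex : (j \in pblock P i) && (i < j)%N by rewrite ji.
pose later (k : 'I_n) := (k \in pblock P i) && (i < k)%N.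
case: (@arg_minnP _ j later (fun k => k : nat) ex) => k /andP[ki ik] kmin.
case/negP: H; apply/existsP; exists k; rewrite ki ik kmin //=.
rewrite inE is_arcE //= ki ik; apply/forall_inP=> l li; apply/negP=> /andP[il lk].
by have := kmin l; rewrite /later li il leqNgt lk => /(_ isT).
Qed.

Lemma ArcK : blocks (Arc P) = P.
Proof.
rewrite -[RHS](equivalence_partition_pblock pP) /blocks /equivalence_partition.
apply: eq_imset => i; apply/setP=> j; rewrite !inE /linked.
wlog ij : i j / (i <= j)%N => [H|].
  by case/orP: (leq_total i j) => /H //; rewrite orbC mem_pblock_sym.
rewrite connect_Arc //; have [//|H] := boolP (j \in _).
rewrite /=; apply: contraNF H => ji.
have E : i = j.
  by apply/val_inj/eqP; rewrite eqn_leq ij (connect_arcs_le strict_Arc ji).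
by rewrite -connect_Arc // E connect0.
Qed.

End BlocksToArcs.

(** [Arc] and [blocks] are mutually inverse, so a sum whose condition and weight depend on the arcs
    alone can be taken over arc sets. *)
Lemma sum_Arc (R : pzRingType) n (q : pred {set 'I_n * 'I_n})
    (F : {set 'I_n * 'I_n} -> R) :
  \sum_(P | set_partition P && q (Arc P)) F (Arc P) =
  \sum_(A | strict A && (compat false A && q A)) F A.
Proof.
rewrite [RHS](reindex_onto (@Arc n) (@blocks n)) /=; last first.
  by move=> A /and3P[sA cA _]; apply: blocksK.
apply: eq_bigl => P; apply/idP/idP=> [/andP[pP qP]|/andP[/and3P[sP cP qP] /eqP PE]].
  by rewrite strict_Arc // compat_Arc // qP ArcK /=.
by rewrite qP andbT -PE blocks_partition.
Qed.

(** * Images of arc sets and an identity for nested subsets *)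

Definition diag n (A : {set 'I_n * 'I_n}) := [set a in A | a.1 == a.2].

Definition endpoints n (A : {set 'I_n * 'I_n}) : {set 'I_n} :=
  [set a.1 | a in A] :|: [set a.2 | a in A].

(** Sets inside the range of [g] are exactly the images, with preimage as inverse; this carries out
    the relabellings of arcs below. *)
Lemma sum_imset (R : nmodType) (T U : finType) (g : T -> U)
    (P : pred {set U}) (F : {set U} -> R) : injective g ->
  \sum_(A : {set U} | (A \subset codom g) && P A) F A =
  \sum_(B : {set T} | P (g @: B)) F (g @: B).
Proof.
move=> gI; rewrite (reindex_onto (fun B : {set T} => g @: B) (fun A : {set U} => g @^-1: A)) /=.
  apply: eq_bigl => B; have -> : g @^-1: (g @: B) = B.
    by apply/setP=> a; rewrite inE mem_imset.
  rewrite eqxx andbT andb_idl // => _; apply/subsetP=> _ /imsetP[a _ ->].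
  exact: codom_f.
move=> A /andP[/subsetP sA _]; apply/setP=> a; apply/imsetP/idP=> [[b + ->]|aA].
  by rewrite inE.
by have /codomP[b E] := sA a aA; exists b => //; rewrite inE -E.
Qed.

Lemma compat_imset c c' k n (h : 'I_k * 'I_k -> 'I_n * 'I_n) (A : {set 'I_k * 'I_k}) :
  (forall a b, compat_rel c' (h a) (h b) = compat_rel c a b) ->
  compat c' (h @: A) = compat c A.
Proof.
move=> hE; apply/compatP/compatP=> H a b.
  by move=> aA bA; rewrite -hE; apply: H; apply: imset_f.
by case/imsetP=> a' aA -> /imsetP[b' bA ->]; rewrite hE; apply: H.
Qed.

Lemma compatS c n (A B : {set 'I_n * 'I_n}) : A \subset B -> compat c B -> compat c A.
Proof.
by move=> /subsetP sAB /compatP H; apply/compatP=> a b /sAB aB /sAB bB; apply: H.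
Qed.

(** Both sides count pairs of nested subsets of sizes [j] and [j + i]; multiplied by the factorials
    of [j], [i] and [n - j - i], each becomes [n!]. *)
Lemma bin_mul_bin n j i : (j + i <= n)%N ->
  ('C(n, j + i) * 'C(j + i, j) = 'C(n, j) * 'C(n - j, i))%N.
Proof.
move=> jin; have jn : (j <= n)%N := leq_trans (leq_addr i j) jin.
have := bin_fact jin; have := bin_fact jn; have := bin_fact (leq_addr i j).
have := @bin_fact (n - j) i; rewrite leq_subRL // => /(_ jin).
rewrite addKn subnDA => <- E1 E2 E3; apply/eqP.
have pos : (0 < j`! * (i`! * (n - j - i)`!))%N by rewrite !muln_gt0 !fact_gt0.
rewrite -(eqn_pmul2r pos); apply/eqP.
transitivity n`!; [rewrite -E3 -E1|rewrite -E2]; ring.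
Qed.

(** * Generating functions of weak, strict and full arc sets *)

Section ArcSums.
Variables (R : comPzRingType) (x y : R).

(* Moving every right endpoint one step down turns the arcs of [n+1] into weak
   arcs of [n], covers into diagonal pairs, and the noncrossing condition into
   the absence of arcs (i, k), (j, l) with i < j <= k < l. *)
Lemma sum_shift c n :
  \sum_(P : {set {set 'I_n.+1}} | set_partition P && (c ==> noncrossing P))
    x ^+ #|Arc P :\: Cov P| * y ^+ #|Cov P| =
  \sum_(A : {set 'I_n * 'I_n} | weak A && compat c A)
    x ^+ #|A :\: diag A| * y ^+ #|diag A|.
Proof.
pose noncr (A : {set 'I_n.+1 * 'I_n.+1}) := [forall a in A, forall b in A,
  ~~ [&& (a.1 < b.1)%N, (b.1 < a.2)%N & (a.2 < b.2)%N]].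
pose cov (A : {set 'I_n.+1 * 'I_n.+1}) := [set p in A | p.2 == p.1.+1 :> nat].
pose shift (a : 'I_n * 'I_n) := (widen_ord (leqnSn n) a.1, lift ord0 a.2).
have shiftI : injective shift.
  by move=> [i j] [k l] [E F]; congr pair; apply: val_inj.
rewrite (@sum_Arc _ _ (fun A => c ==> noncr A)
          (fun A => x ^+ #|A :\: cov A| * y ^+ #|cov A|)).
transitivity (\sum_(A : {set 'I_n.+1 * 'I_n.+1} | (A \subset codom shift) &&
    (strict A && (compat false A && (c ==> noncr A))))
    x ^+ #|A :\: cov A| * y ^+ #|cov A|).
  (* In a strict pair the left end is not the last point and the right end is not the first, so
     strict sets lie in the range of [shift]. *)
  apply: eq_bigl => A; rewrite [RHS]andb_idl // => /andP[/strictP sA _].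
  apply/subsetP=> -[i j] /sA /= ij; apply/codomP.
  have i_n : (i < n)%N by have := ltn_ord j; lia.
  have j_n : (j.-1 < n)%N by have := ltn_ord j; lia.
  exists (Ordinal i_n, Ordinal j_n); congr pair; apply: val_inj => //=.
  by rewrite /bump add1n prednK //; apply: leq_ltn_trans ij.
rewrite sum_imset //; apply: eq_big => [A|A _].
  have -> : strict (shift @: A) = weak A.
    apply/strictP/weakP=> H a.
      by move=> aA; apply: (H _ (imset_f shift aA)).
    by case/imsetP=> b bA -> /=; apply: H.
  rewrite (@compat_imset false) => [|a b]; last first.
    by rewrite /compat_rel /= -(inj_eq shiftI).
  congr andb; apply/andP/compatP=> [[/compatP H1 H2] a b aA bA|H].
    have := H1 a b aA bA; rewrite /compat_rel andbT => -> /=.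
    apply/implyP=> cT; move: H2; rewrite cT => /forall_inP/(_ _ (imset_f shift aA)).
    by move/forall_inP/(_ _ (imset_f shift bA)).
  split.
    by apply/compatP=> a b aA bA; case/andP: (H a b aA bA) => H1 _; apply/andP.
  apply/implyP=> cT; apply/forall_inP=> _ /imsetP[a aA ->].
  apply/forall_inP=> _ /imsetP[b bA ->].
  by case/andP: (H a b aA bA); rewrite cT.
have -> : cov (shift @: A) = shift @: diag A.
  apply/setP=> a; rewrite inE; apply/andP/imsetP=> [[/imsetP[b bA ->] /= E]|[b + ->]].
    by exists b; rewrite // inE bA -val_eqE /= eq_sym -eqSS.
  rewrite inE => /andP[bA /eqP E]; split; first exact: imset_f.
  by rewrite /= E.
have -> : shift @: A :\: shift @: diag A = shift @: (A :\: diag A).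
  apply/setP=> a; rewrite inE; apply/andP/imsetP=> [[+ /imsetP[b bA E]]|[b + ->]].
    by rewrite E mem_imset // => bD; exists b; rewrite // inE bD bA.
  by rewrite !(mem_imset _ _ shiftI) inE => /andP[].
by rewrite !card_imset.
Qed.

(** The four choices of [c] and [full] give known polynomials: false, false is [Bx]; false, true is
    [Fe]; true, false is [Mo]; true, true counts noncrossing perfect matchings. *)
Definition arc_sum (c full : bool) n :=
  \sum_(A : {set 'I_n * 'I_n} |
     [&& strict A, compat c A & full ==> (endpoints A == setT)]) x ^+ #|A|.

(** [enum S] is a subsequence of the increasing list of all points, hence increasing. *)
Lemma enum_val_ltn n (S : {set 'I_n}) (i j : 'I_#|S|) :
  (enum_val i < enum_val j)%N = (i < j)%N.
Proof.
have mono (k l : 'I_#|S|) : (k < l)%N -> (enum_val k < enum_val l)%N.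
  move=> kl; have sE : sorted ltn [seq val i | i <- enum S].
    rewrite -[enum _]/(filter (mem S) (Finite.enum 'I_n)) -enumT sorted_map.
    apply: sorted_filter; first by move=> ? ? ?; apply: ltn_trans.
    by rewrite -sorted_map val_enum_ord iota_ltn_sorted.
  have := sorted_ltn_nth ltn_trans 0%N sE.
  rewrite (enum_val_nth (enum_val k)) (enum_val_nth (enum_val k) l).
  move/(_ k l); rewrite !inE size_map -cardE !ltn_ord => /(_ isT isT kl).
  by rewrite !(nth_map (enum_val k)) -?cardE.
apply/idP/idP; last exact: mono.
apply: contraTT; rewrite -!leqNgt leq_eqVlt => /predU1P[/val_inj -> //|/mono/ltnW //].
Qed.

(** The increasing relabelling of [S] preserves every condition involved, so the sum depends on [S]
    only through its size. *)
Lemma sum_sub_setX c full n (S : {set 'I_n}) :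
  \sum_(A : {set 'I_n * 'I_n} | (A \subset setX S S) &&
     [&& strict A, compat c A & full ==> (endpoints A == S)]) x ^+ #|A| =
  arc_sum c full #|S|.
Proof.
pose f (a : 'I_#|S| * 'I_#|S|) := (enum_val a.1, enum_val a.2).
have fI : injective f by move=> [i j] [k l] [/enum_val_inj-> /enum_val_inj->].
have leE (i j : 'I_#|S|) : (enum_val i <= enum_val j)%N = (i <= j)%N.
  by rewrite leqNgt enum_val_ltn -leqNgt.
transitivity (\sum_(A : {set 'I_n * 'I_n} | (A \subset codom f) &&
     [&& strict A, compat c A & full ==> (endpoints A == S)]) x ^+ #|A|).
  apply: eq_bigl => A; congr andb; apply: eq_subset_r => -[i j].
  apply/setXP/codomP=> [[iS jS]|[a [-> ->]]]; last by split; apply: enum_valP.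
  exists (enum_rank_in iS i, enum_rank_in iS j); by rewrite /f /= !enum_rankK_in.
rewrite sum_imset //; apply: eq_big => [A|A _]; last by rewrite card_imset.
congr [&& _, _ & _ ==> _].
- apply/strictP/strictP=> H a.
    by move=> aA; rewrite -enum_val_ltn; apply: (H _ (imset_f f aA)).
  by case/imsetP=> b bA -> /=; rewrite enum_val_ltn; apply: H.
- apply: compat_imset => a b; rewrite /compat_rel /= !enum_val_ltn leE.
  by rewrite !(inj_eq enum_val_inj) -(inj_eq fI).
have -> : endpoints (f @: A) = enum_val @: endpoints A.
  by rewrite /endpoints imsetU -!imset_comp.
have ES : S = enum_val @: [set: 'I_#|S|].
  apply/setP=> i; apply/idP/imsetP=> [iS|[j _ ->]]; last exact: enum_valP.
  by exists (enum_rank_in iS i); rewrite ?enum_rankK_in ?inE.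
apply/eqP/eqP=> [E|->]; last exact/esym.
by apply: (imset_inj (@enum_val_inj _ S)); rewrite E -ES.
Qed.

Lemma sum_card_set n (G : nat -> R) :
  \sum_(S : {set 'I_n}) G #|S| = \sum_(0 <= k < n.+1) 'C(n, k)%:R * G k.
Proof.
rewrite big_mkord (partition_big (fun S : {set 'I_n} => inord #|S| : 'I_n.+1) predT) //=.
apply: eq_bigr => k _; transitivity (\sum_(S : {set 'I_n} | #|S| == k) G k).
  apply: eq_big => [S|S /eqP <-].
    by rewrite -val_eqE /= inordK // ltnS -[X in (_ <= X)%N]card_ord max_card.
  by rewrite inordK // ltnS -[X in (_ <= X)%N]card_ord max_card.
rewrite sumr_const mulr_natl -[X in 'C(X, _)]card_ord -card_draws.
by congr (_ *+ _); apply: eq_card => S; rewrite inE.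
Qed.

Lemma sub_endpoints n (A : {set 'I_n * 'I_n}) : A \subset setX (endpoints A) (endpoints A).
Proof.
apply/subsetP=> a aA; rewrite !inE.
by rewrite (imset_f fst aA) (imset_f snd aA) orbT.
Qed.

(** Arc sets are grouped by the set of their endpoints, on which they become full. *)
Lemma arc_sum_endpoints c n :
  arc_sum c false n = \sum_(0 <= k < n.+1) 'C(n, k)%:R * arc_sum c true k.
Proof.
rewrite -sum_card_set /arc_sum (partition_big (@endpoints n) predT) //=.
apply: eq_bigr => S _; rewrite -[RHS](@sum_sub_setX c true).
apply: eq_bigl => A; rewrite andbT /= -andbA [RHS]andb_idl //.
by case/and3P=> _ _ /eqP<-; apply: sub_endpoints.
Qed.

(** Weak sets are grouped by the set [S] of points without a diagonal pair. The remaining pairs form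
    a strict set on [S], and each point outside [S] contributes a factor [y]. *)
Lemma sum_weak c n :
  \sum_(A : {set 'I_n * 'I_n} | weak A && compat c A)
    x ^+ #|A :\: diag A| * y ^+ #|diag A| =
  \sum_(0 <= k < n.+1) 'C(n, k)%:R * arc_sum c false k * y ^+ (n - k).
Proof.
transitivity (\sum_(S : {set 'I_n}) arc_sum c false #|S| * y ^+ (n - #|S|)); last first.
  rewrite (sum_card_set _ (fun k => arc_sum c false k * y ^+ (n - k))).
  by apply: eq_bigr => k _; rewrite mulrA.
pose dg (D : {set 'I_n}) := [set (i, i) | i in D].
have dgP D a : (a \in dg D) = (a.1 == a.2) && (a.1 \in D).
  case: a => i j; apply/imsetP/andP=> /= [[k kD [-> ->]] //|[/eqP <- iD]].
  by exists i.
rewrite (partition_big (fun A : {set 'I_n * 'I_n} => ~: [set i | (i, i) \in A]) predT) //=.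
apply: eq_bigr => S _; rewrite -(@sum_sub_setX c false) big_distrl /=.
(* With [S] fixed, the diagonal part is [dg (~: S)]; adding it and removing it are inverse to each
   other. *)
rewrite (reindex_onto (fun A : {set 'I_n * 'I_n} => A :|: dg (~: S))
    (fun A : {set 'I_n * 'I_n} => A :\: dg (~: S))) /=; last first.
  move=> A /andP[_ /eqP SA]; apply/setP=> -[i j].
  rewrite !inE dgP -SA !inE /= negbK; case: eqVneq => [->|_] /=; last by rewrite orbF.
  by rewrite andNb.
have dgD (A : {set 'I_n * 'I_n}) : A \subset setX S S -> A :&: dg (~: S) = set0.
  move=> /subsetP sA; apply/setP=> a; rewrite !inE dgP inE.
  apply/negP=> /andP[/sA]; rewrite inE => /andP[-> _]; by rewrite andbF.
have predE (A : {set 'I_n * 'I_n}) : (weak (A :|: dg (~: S)) && compat c (A :|: dg (~: S)) &&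
    (~: [set i | (i, i) \in A :|: dg (~: S)] == S) &&
    ((A :|: dg (~: S)) :\: dg (~: S) == A)) =
    (A \subset setX S S) && [&& strict A, compat c A & true].
  rewrite andbT; apply/idP/and3P.
    case/andP=> /andP[/andP[/weakP wA cA] /eqP SA] /eqP DA.
    have sA : strict A.
      apply/strictP=> -[i j] aA; have ij : (i <= j)%N by apply: (wA (i, j)); rewrite inE aA.
      have aD : (i, j) \notin dg (~: S) by move: aA; rewrite -{1}DA inE => /andP[].
      rewrite ltn_neqAle ij andbT; apply: contraNneq aD => /val_inj /= E.
      rewrite E in aA *; rewrite dgP eqxx inE -SA inE negbK inE.
      by rewrite inE aA.
    split=> //; last by apply: compatS cA; apply: subsetUl.
    apply/subsetP=> a aA; have aA' : a \in A :|: dg (~: S) by rewrite inE aA.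
    (* A strict pair with an end outside [S] would share a row or a column with a diagonal pair,
       hence be equal to it. *)
    have out i : (a.1 == i) || (a.2 == i) -> i \in S.
      move=> ai; apply: contraT => iS; have iA : (i, i) \in A :|: dg (~: S).
        by rewrite inE dgP /= eqxx inE iS orbT.
      have := compatP _ _ cA _ _ aA' iA; rewrite /compat_rel ai /= => /andP[/eqP E _].
      by have := strictP _ sA _ aA; rewrite E ltnn.
    by rewrite inE !out ?eqxx ?orbT.
  case=> SA sA cA; have SA' := subsetP SA.
  apply/andP; split; first apply/andP; first split; first apply/andP; first split.
  - apply/weakP=> a /setUP[/(strictP _ sA)/ltnW //|].
    by rewrite dgP => /andP[/eqP-> _].
  (* A diagonal pair never occurs in a chain [a.1 < b.1 <= a.2 < b.2], so as soon as such a pair is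
     involved only common rows and columns matter. *)
  - apply/compatP=> -[i j] [k l]; rewrite !inE /compat_rel /= => /orP[aA|aD] /orP[bA|bD].
    + exact: (compatP _ _ cA _ _ aA bA).
    + move: bD (SA' _ aA); rewrite dgP !inE /= => /andP[/eqP <- kS] /andP[iS jS].
      have /negPf-> : ~~ ((i == k) || (j == k)).
        by rewrite negb_or; apply/andP; split; apply: contraNneq kS => <-.
      by apply/implyP=> _; lia.
    + move: aD (SA' _ bA); rewrite dgP !inE /= => /andP[/eqP <- iS] /andP[kS lS].
      have /negPf-> : ~~ ((i == k) || (i == l)).
        by rewrite negb_or; apply/andP; split; apply: contraNneq iS => ->.
      by apply/implyP=> _; lia.
    + move: aD bD; rewrite !dgP /= => /andP[/eqP <- _] /andP[/eqP <- _].
      rewrite orbb; apply/andP; split; last by apply/implyP=> _; lia.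
      by apply/implyP=> /eqP->.
  - apply/eqP/setP=> i; rewrite [dg _]lock !inE -lock dgP /= eqxx inE /=.
    case: (boolP (_ \in A)) => [/(strictP _ sA)|_]; first by rewrite ltnn.
    by rewrite negbK.
  by rewrite setDUl setDv setU0; apply/eqP/setDidPl; rewrite -setI_eq0 dgD.
apply: eq_big => // A; rewrite predE => /andP[SA /and3P[sA _ _]].
have -> : diag (A :|: dg (~: S)) = dg (~: S).
  apply/setP=> a; rewrite [dg _]lock !inE -lock dgP.
  case: (boolP (a \in A)) => [/(strictP _ sA) aa|_] /=.
    by rewrite -val_eqE /= ltn_eqF.
  by rewrite andbAC andbb.
rewrite setDUl setDv setU0; have -> : A :\: dg (~: S) = A.
  by apply/setDidPl; rewrite -setI_eq0 dgD.
congr (_ * _ ^+ _); rewrite card_imset; last by move=> ? ? [].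
by rewrite cardsCs setCK card_ord.
Qed.

(** After exchanging the sums, [bin_mul_bin] extracts ['C(n, j)], and what remains is the binomial
    expansion of [(y + 1) ^+ (n - j)]. *)
Lemma sum_binomial2 n (G : nat -> R) :
  \sum_(0 <= k < n.+1) 'C(n, k)%:R * (\sum_(0 <= j < k.+1) 'C(k, j)%:R * G j)
    * y ^+ (n - k) =
  \sum_(0 <= j < n.+1) 'C(n, j)%:R * G j * (y + 1) ^+ (n - j).
Proof.
transitivity (\sum_(0 <= k < n.+1) \sum_(0 <= j < n.+1)
    'C(n, k)%:R * ('C(k, j)%:R * G j) * y ^+ (n - k)).
  apply: eq_big_nat => k /andP[_ kn]; rewrite big_distrr big_distrl /=.
  rewrite [RHS](@big_cat_nat _ _ _ k.+1) //= [X in _ + X]big_nat [X in _ + X]big1 ?addr0 // => j.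
  by case/andP=> kj _; rewrite (bin_small kj) mul0r mulr0 mul0r.
rewrite exchange_big_nat; apply: eq_big_nat => j /andP[_ jn].
(* The terms with [k < j] vanish; the others are indexed by [k = j + i]. *)
rewrite (@big_cat_nat _ _ _ j) //=; last exact: leqW.
rewrite [X in X + _]big_nat [X in X + _]big1 ?add0r => [|k /andP[_ kj]]; last first.
  by rewrite (bin_small kj) mul0r mulr0 mul0r.
rewrite -{1}[j]add0n big_addn subSn // exprDn big_mkord big_distrr /=.
apply: eq_bigr => i _; have iN : (i <= n - j)%N by rewrite -ltnS.
rewrite expr1n mulr1 -[y ^+ (n - j - i) *+ _]mulr_natl addnC -subnDA [RHS]mulrACA.
rewrite -natrM -bin_mul_bin; last by rewrite -leq_subRL.
by rewrite natrM !mulrA.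
Qed.

End ArcSums.

(** * Feasible, poor and noncrossing partitions read off their arcs *)

Section PartitionArcs.
Variables (n : nat) (P : {set {set 'I_n}}).
Hypothesis pP : set_partition P.

(** The witnesses are the first and the last arc of the path from [i] to [j] inside the block. *)
Lemma arc_from_to (i j : 'I_n) : (i < j)%N -> j \in pblock P i ->
  (exists k, ((i, k) \in Arc P)) /\ (exists k, ((k, j) \in Arc P)).
Proof.
move=> ij; rewrite -(connect_Arc pP) 1?ltnW // => /connectP[p].
case: p => [_ E|k p /=]; first by rewrite E ltnn in ij.
case/andP=> ik pk lj; split; first by exists k.
case/lastP: p pk lj => [_ /= ->|p l]; first by exists i.
rewrite last_rcons rcons_path => /andP[_ kl] ->; by exists (last k p).
Qed.

Lemma mem_ArcP (i j : 'I_n) : (i, j) \in Arc P -> (i < j)%N /\ j \in pblock P i.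
Proof. by rewrite inE is_arcE //= => /and3P[]. Qed.

Lemma pblock_self (i : 'I_n) : i \in pblock P i.
Proof. by case/and3P: pP => /eqP cP _ _; rewrite mem_pblock cP inE. Qed.

Lemma blockP (B : {set 'I_n}) i j : B \in P -> i \in B -> j \in B -> j \in pblock P i.
Proof. by case/and3P: pP => _ tP _ BP iB; rewrite (def_pblock tP BP iB). Qed.

(** A second point in the block of [i] forces an arc leaving [i] if it lies above [i], and an arc
    entering [i] if it lies below; conversely an arc has two ends in one block. *)
Lemma feasible_Arc : feasible P = (endpoints (Arc P) == [set: 'I_n]).
Proof.
apply/forall_inP/eqP=> [H|H B BP].
  apply/setP=> i; rewrite inE [RHS]inE.
  have bP : pblock P i \in P by case/and3P: pP => /eqP cP _ _; rewrite pblock_mem // cP.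
  have /card_gt1P[j [k [jb kb jk]]] := H _ bP.
  have [l li ln] : exists2 l, l \in pblock P i & l != i.
    by case: (eqVneq j i) => [ji|]; [exists k; rewrite // -ji eq_sym|exists j].
  apply/orP; case: (ltngtP i l) => [il|il|/val_inj E]; last by rewrite E eqxx in ln.
    by have [[k' aP] _] := arc_from_to il li; left; apply: (imset_f fst aP).
  rewrite mem_pblock_sym // in li.
  by have [_ [k' aP]] := arc_from_to il li; right; apply: (imset_f snd aP).
have [i iB] : exists i, i \in B.
  by case/and3P: pP => _ _ P0; apply/set0Pn; apply: contraNneq P0 => <-.
have : i \in endpoints (Arc P) by rewrite H inE.
have BE : B = pblock P i by case/and3P: pP => _ tP _; rewrite (def_pblock tP BP iB).
rewrite BE inE => /orP[]/imsetP[[k l] /mem_ArcP[kl lb] /= ->]; apply/card_gt1P.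
  by exists k, l; rewrite pblock_self -val_eqE /= neq_ltn kl.
by exists k, l; rewrite pblock_self (mem_pblock_sym pP) lb -val_eqE /= neq_ltn kl.
Qed.

(** Strict inequality in the middle of the forbidden chain is a crossing. Equality means two
    consecutive arcs, which exist exactly when some block has three elements. *)
Lemma noncrossing_poor_Arc : noncrossing P && poor P = compat true (Arc P).
Proof.
apply/andP/compatP=> [[/forall_inP nc /forall_inP po] a b aP bP|H].
  have := compatP _ _ (compat_Arc pP) _ _ aP bP.
  rewrite /compat_rel andbT => -> /=; apply/negP=> /and3P[ab1 ba ab2].
  have /forall_inP/(_ _ bP) := nc _ aP; rewrite ab1 ab2 andbT /=.
  move: ba; rewrite leq_eqVlt => /orP[/eqP/val_inj E _|-> //].
  case: a b aP bP ab1 ab2 E => i j [k l] /= aP bP ik jl kj; subst k.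
  have [[ij ji] [_ lj]] := (mem_ArcP aP, mem_ArcP bP).
  have bl : pblock P i \in P by case/and3P: pP => /eqP cP _ _; rewrite pblock_mem // cP.
  have := po _ bl; rewrite leqNgt => /negP; apply; apply/card_gt2P; exists i, j, l.
  rewrite pblock_self ji (mem_pblock_trans pP ji lj) -!val_eqE /=.
  by do 2 split=> //; lia.
split.
  apply/forall_inP=> a aP; apply/forall_inP=> b bP.
  by case/andP: (H a b aP bP) => _ /=; apply: contra => /and3P[-> /ltnW -> ->].
apply/forall_inP=> B BP; rewrite leqNgt; apply/negP=> /card_gt2P.
case=> [i1 [i2 [i3 [[m1 m2 m3] [d1 d2 d3]]]]].
have noarcs (i j k : 'I_n) : i \in B -> j \in B -> k \in B -> (i < j < k)%N -> False.
  move=> iB jB kB /andP[ij jk].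
  have [_ [l ljP]] := arc_from_to ij (blockP BP iB jB).
  have [[m jmP] _] := arc_from_to jk (blockP BP jB kB).
  case/andP: (H _ _ ljP jmP) => _ /=; rewrite leqnn.
  by have [[-> _] [-> _]] := (mem_ArcP ljP, mem_ArcP jmP).
move: d1 d2 d3; rewrite -!val_eqE /= => d1 d2 d3.
have : [|| (i1 < i2 < i3), (i1 < i3 < i2), (i2 < i1 < i3), (i2 < i3 < i1),
  (i3 < i1 < i2) | (i3 < i2 < i1)]%N by lia.
by case/or4P=> [|||/or3P[||]]; apply: noarcs.
Qed.

End PartitionArcs.

Lemma Fe_arc_sum (R : comPzRingType) n (x : R) : Fe n x = arc_sum x false true n.
Proof.
pose q (A : {set 'I_n * 'I_n}) := endpoints A == setT.
transitivity (\sum_(P : {set {set 'I_n}} | set_partition P && q (Arc P)) x ^+ #|Arc P|).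
  by apply: eq_bigl => P; apply: andb_id2l => pP; rewrite feasible_Arc.
by rewrite (@sum_Arc _ _ q (fun A => x ^+ #|A|)).
Qed.

Lemma Mo_arc_sum (R : comPzRingType) n (x : R) : Mo n x = arc_sum x true false n.
Proof.
transitivity (\sum_(P : {set {set 'I_n}} | set_partition P && compat true (Arc P)) x ^+ #|Arc P|).
  by apply: eq_bigl => P; apply: andb_id2l => pP; rewrite noncrossing_poor_Arc.
rewrite (@sum_Arc _ _ (compat true (n := n)) (fun A => x ^+ #|A|)).
apply: eq_bigl => A; rewrite andbT; congr andb; apply: andb_idl.
move=> /compatP H; apply/compatP=> a b aA bA.
by case/andP: (H a b aA bA) => H1 _; apply/andP.
Qed.

Lemma Bx_arc_sum (R : comPzRingType) n (x : R) : Bx n x = arc_sum x false false n.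
Proof.
transitivity (\sum_(P : {set {set 'I_n}} | set_partition P && true) x ^+ #|Arc P|).
  apply: eq_big => [P|P _]; first by rewrite andbT.
  rewrite -exprD; congr (_ ^+ _); have -> : Cov P = Arc P :&: Cov P.
    by apply/esym/setIidPr/subsetP=> a; rewrite inE => /andP[].
  by rewrite setDIr setDv set0U addnC cardsID.
by rewrite (@sum_Arc _ _ predT (fun A => x ^+ #|A|)).
Qed.

(** * Open noncrossing matchings and removal of the last point *)

Definition exposed m (A : {set 'I_m * 'I_m}) :=
  [forall a in A, forall j in ~: endpoints A, ~~ (a.1 < j < a.2)%N].

(** This encodes a prefix of a ballot word: the [h] points on no arc are openers still to be closed,
    so no arc may pass over them. *)
Definition open_matching m h (A : {set 'I_m * 'I_m}) :=
  [&& strict A, compat true A, exposed A & #|~: endpoints A| == h].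

Lemma exposedP m (A : {set 'I_m * 'I_m}) :
  reflect (forall a j, a \in A -> j \notin endpoints A -> ~~ (a.1 < j < a.2)%N)
    (exposed A).
Proof.
apply: (iffP forall_inP) => [H a j aA jA|H a aA].
  by apply: (forall_inP (H a aA)); rewrite inE.
by apply/forall_inP => j; rewrite inE; apply: H.
Qed.

Lemma endpointsP m (A : {set 'I_m * 'I_m}) i :
  reflect (exists2 a, a \in A & (a.1 == i) || (a.2 == i)) (i \in endpoints A).
Proof.
apply: (iffP setUP) => [[]/imsetP[a aA ->]|[a aA /orP[]/eqP <-]].
- by exists a; rewrite ?eqxx.
- by exists a; rewrite ?eqxx ?orbT.
- by left; apply: imset_f.
- by right; apply: (imset_f snd).
Qed.

Section Peel.
Variable n : nat.
Implicit Types (B : {set 'I_n * 'I_n}) (S : {set 'I_n}).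

Let u : 'I_n -> 'I_n.+1 := widen_ord (leqnSn n).

Definition widen_arcs (B : {set 'I_n * 'I_n}) : {set 'I_n.+1 * 'I_n.+1} :=
  [set (u a.1, u a.2) | a in B].

Definition add_arc (t : 'I_n.+1) (B : {set 'I_n * 'I_n}) :=
  (t, ord_max) |: widen_arcs B.

Lemma u_inj : injective u.
Proof. by move=> i j [E]; apply: val_inj. Qed.

Lemma u_max i : (u i == ord_max) = false.
Proof. by apply/negbTE; rewrite -val_eqE /= neq_ltn ltn_ord. Qed.

Lemma uP (i : 'I_n.+1) : i != ord_max -> {j | i = u j}.
Proof.
rewrite -val_eqE /= => H; have iN : (i < n)%N by have := ltn_ord i; lia.
by exists (Ordinal iN); apply: val_inj.
Qed.

Lemma mem_widen B i j : ((u i, u j) \in widen_arcs B) = ((i, j) \in B).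
Proof.
apply/imsetP/idP=> [[[k l] kB [/val_inj-> /val_inj->]] //|iB].
by exists (i, j).
Qed.

Lemma widen_arcsP B a : reflect (exists2 b, b \in B & a = (u b.1, u b.2)) (a \in widen_arcs B).
Proof. exact: imsetP. Qed.

Lemma strict_widen B : strict (widen_arcs B) = strict B.
Proof.
apply/strictP/strictP=> H a.
  by move=> aB; apply: (H (u a.1, u a.2)); rewrite mem_widen; case: a aB.
by case/widen_arcsP=> b bB ->; apply: H.
Qed.

Lemma compat_widen c B : compat c (widen_arcs B) = compat c B.
Proof. by apply: compat_imset. Qed.

Lemma endpoints_widen B : endpoints (widen_arcs B) = u @: endpoints B.
Proof. by rewrite /endpoints imsetU -!imset_comp. Qed.

Lemma setC_imset_u S : ~: (u @: S) = ord_max |: u @: ~: S.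
Proof.
apply/setP=> i; rewrite !inE; case: eqVneq => [->|/uP[j ->]] /=.
  by apply/imsetP=> -[j _ /esym/eqP]; rewrite u_max.
by rewrite !(mem_imset _ _ u_inj) inE.
Qed.

Lemma max_notin_u S : ord_max \notin u @: S.
Proof. by apply/imsetP=> -[j _ /esym/eqP]; rewrite u_max. Qed.

(** The new last point lies under no arc and is open, so only the number of open points changes. *)
Lemma open_matching_widen h B :
  open_matching h (widen_arcs B) = (0 < h)%N && open_matching h.-1 B.
Proof.
rewrite /open_matching strict_widen compat_widen.
have -> : exposed (widen_arcs B) = exposed B.
  apply/exposedP/exposedP=> H.
    move=> a j aB jB; apply: (H (u a.1, u a.2) (u j)).
      by rewrite mem_widen; case: a aB.
    by rewrite endpoints_widen (mem_imset _ _ u_inj).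
  move=> _ j /widen_arcsP[b bB ->]; rewrite endpoints_widen /=.
  have [->|/uP[k ->]] := eqVneq j ord_max; first by have := ltn_ord b.2; rewrite /=; lia.
  by rewrite (mem_imset _ _ u_inj); apply: H.
rewrite endpoints_widen setC_imset_u cardsU1 max_notin_u (card_imset _ u_inj) add1n.
by case: h => [|h]; rewrite ?eqSS ?andbF.
Qed.

(** The last open point is the only one that a new closer can be matched with. *)
Definition is_top (B : {set 'I_n * 'I_n}) t :=
  (t \notin endpoints B) && [forall j in ~: endpoints B, (j <= t)%N].

Lemma add_arcP t B a :
  reflect (a = (t, ord_max) \/ exists2 b, b \in B & a = (u b.1, u b.2)) (a \in add_arc t B).
Proof.
by apply: (iffP setU1P) => -[]; [left|move/widen_arcsP; right|left|move/widen_arcsP; right].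
Qed.

Lemma endpoints_add t B : endpoints (add_arc (u t) B) = ord_max |: (u @: (t |: endpoints B)).
Proof.
rewrite imsetU1 -endpoints_widen {1}/endpoints /add_arc !imsetU1 setUACA /=.
by rewrite [X in X :|: _]setUC -setUA.
Qed.

Lemma mem_endpoints_add t B j :
  (u j \in endpoints (add_arc (u t) B)) = (j == t) || (j \in endpoints B).
Proof. by rewrite endpoints_add in_setU1 u_max (mem_imset _ _ u_inj) in_setU1. Qed.

(** An open point after [t] would lie under the new arc, and an old arc crossing the new one would
    pass over [t], which is open in [B]. *)
Lemma open_matching_add h t B :
  open_matching h (add_arc (u t) B) = open_matching h.+1 B && is_top B t.
Proof.
have mB b : b \in B -> (u b.1, u b.2) \in add_arc (u t) B.
  by move=> bB; apply/add_arcP; right; exists b.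
have mT : (u t, ord_max) \in add_arc (u t) B by apply/add_arcP; left.
have cardE : t \notin endpoints B ->
    #|~: endpoints B| = #|~: endpoints (add_arc (u t) B)|.+1.
  move=> tB; rewrite (cardsD1 t) inE tB add1n endpoints_add.
  have -> : ~: (ord_max |: u @: (t |: endpoints B)) = u @: (~: endpoints B :\ t).
    rewrite setDE -setCU setUC; apply/setP=> i; rewrite !inE.
    case: eqVneq => [->|/uP[j ->]] /=. 
      by rewrite !(negPf (max_notin_u _)).
    by rewrite !(mem_imset _ _ u_inj) !inE orbF orbC.
  by rewrite card_imset //; apply: u_inj.
apply/idP/idP=> [/and4P[sA cA eA hA]|/andP[/and4P[sB cB eB hB] /andP[tB /forall_inP tt]]].
  have sB : strict B.
    rewrite -strict_widen; apply/strictP=> a aB.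
    by apply: (strictP _ sA); rewrite inE aB orbT.
  have cB : compat true B by rewrite -compat_widen; apply: compatS cA; apply: subsetUr.
  (* An old arc starting at [t] would share a row with the new arc; one ending at [t] would form
     with it the chain excluded by the weak inequality. *)
  have tB : t \notin endpoints B.
    apply/endpointsP=> -[b bB /orP[]/eqP E].
      have := compatP _ _ cA _ _ (mB _ bB) mT.
      rewrite /compat_rel E eqxx /= => /andP[/eqP[E2] _].
      have := ltn_ord b.2. by rewrite E2 ltnn.
    have := compatP _ _ cA _ _ (mB _ bB) mT; rewrite /compat_rel /= => /andP[_].
    by rewrite -E leqnn (strictP _ sB _ bB) ltn_ord.
  rewrite /open_matching sB cB cardE // eqSS hA andbT /=; apply/andP; split.
    apply/exposedP=> b j bB jB; apply/negP=> /= bj.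
    (* The point [t] is no longer open after the addition, so an arc over it is excluded by
       noncrossing; any other open point of [B] stays open. *)
    have [jt|jt] := eqVneq j t.
      have := compatP _ _ cA _ _ (mB _ bB) mT; rewrite /compat_rel /= => /andP[_].
      by rewrite -jt; case/andP: bj => -> /ltnW ->; rewrite ltn_ord.
    have := exposedP _ eA _ (u j) (mB _ bB); rewrite mem_endpoints_add negb_or.
    by rewrite jt jB bj => /(_ isT).
  rewrite /is_top tB; apply/forall_inP=> j; rewrite inE => jB.
  rewrite leqNgt; apply/negP=> tj.
  have := exposedP _ eA _ (u j) mT; rewrite mem_endpoints_add negb_or jB.
  rewrite -val_eqE neq_ltn tj orbT => /(_ isT). by rewrite /= ltn_ord.
apply/and4P; split; last by rewrite -eqSS -cardE.
- by apply/strictP=> a /add_arcP[->|[b bB ->]] /=; [apply: ltn_ord|apply: (strictP _ sB)].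
- have tn b : b \in B -> (b.1 == t = false) * (b.2 == t = false).
    by move=> bB; split; apply: contraNF tB => E; apply/endpointsP; exists b; rewrite ?E ?orbT.
  apply/compatP=> _ _ /add_arcP[->|[a aB ->]] /add_arcP[->|[b bB ->]].
  + by rewrite /compat_rel !eqxx /= ltnn.
  + rewrite /compat_rel /= [u t == _]eq_sym (inj_eq u_inj) (tn _ bB) eq_sym u_max /=.
    by rewrite [(n < _)%N]ltnNge (ltnW (ltn_ord b.2)) !andbF.
  + rewrite /compat_rel /= (inj_eq u_inj) (tn _ aB) u_max /=.
    apply/negP=> /and3P[at1 ta _]; have := exposedP _ eB _ _ aB tB.
    by rewrite at1 ltn_neqAle ta andbT val_eqE eq_sym (tn _ aB).
  + by have := compatP _ _ cB _ _ aB bB.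
- apply/exposedP=> a j /add_arcP aB; case: (eqVneq j ord_max) => [->|/uP[i ->]].
    by rewrite endpoints_add setU11.
  rewrite mem_endpoints_add negb_or => /andP[it iB].
  case: aB => [->|[b bB ->]] /=; last exact: (exposedP _ eB).
  have it' : (i <= t)%N by apply: tt; rewrite inE.
  by rewrite [(t < i)%N]ltnNge it'.
Qed.

Variables (R : comPzRingType) (x : R).
Implicit Type h : nat.

Definition open_sum m h :=
  \sum_(A : {set 'I_m * 'I_m} | open_matching h A) x ^+ #|A|.

(** With no open point the maximum takes the default value 0, and then [is_top] fails for every
    [t]. *)
Definition top B : 'I_n.+1 := inord (\max_(j in ~: endpoints B) j).

Definition restrict_arcs (A : {set 'I_n.+1 * 'I_n.+1}) : {set 'I_n * 'I_n} :=
  [set a | (u a.1, u a.2) \in A].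

Lemma topE B t : is_top B t -> top B = u t.
Proof.
case/andP=> tB /forall_inP tt; have E : \max_(j in ~: endpoints B) (j : nat) = t :> nat.
  apply/eqP; rewrite eqn_leq; apply/andP; split; first by apply/bigmax_leqP.
  by apply: (@leq_bigmax_cond _ _ (@nat_of_ord n) t); rewrite inE.
by apply: val_inj; rewrite /top E /= inordK // ltnS ltnW.
Qed.

Lemma ex_top B : (0 < #|~: endpoints B|)%N -> {t | is_top B t}.
Proof.
case/(eq_bigmax_cond (@nat_of_ord n)) => t; rewrite inE => tB E.
exists t; rewrite /is_top tB; apply/forall_inP=> j jB.
by rewrite -E; apply: (@leq_bigmax_cond _ _ (@nat_of_ord n) j).
Qed.

Lemma add_arcK t B : restrict_arcs (add_arc t B) = B.
Proof.
by apply/setP=> -[i j]; rewrite inE in_setU1 mem_widen xpair_eqE u_max andbF.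
Qed.

Lemma card_add_arc t B : #|add_arc t B| = #|B|.+1.
Proof.
rewrite cardsU1 card_imset => [|[i j] [k l] [/val_inj-> /val_inj->] //].
case: imsetP => [[a _ [_ E]]|//].
by have := ltn_ord a.2; rewrite -E ltnn.
Qed.

(** By strictness the last point can only be a right end, and by compatibility just one arc reaches
    it; all other arcs live on the first [n] points. *)
Lemma restrict_arcsK (A : {set 'I_n.+1 * 'I_n.+1}) :
  strict A -> compat true A -> ord_max \in endpoints A ->
  exists t, add_arc (u t) (restrict_arcs A) = A.
Proof.
move=> sA cA /endpointsP[[i j] aA /= ij].
have lij := strictP _ sA _ aA; rewrite /= in lij.
have jm : j = ord_max.
  by case/orP: ij => /eqP E //; move: lij; rewrite E ltnNge -ltnS ltn_ord.
have /uP[t it] : i != ord_max by rewrite -jm -val_eqE /= neq_ltn lij.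
exists t; rewrite -it; apply/setP=> b; rewrite in_setU1.
apply/orP/idP=> [[/eqP->|/widen_arcsP[c + ->]]|bA].
- by rewrite -jm.
- by rewrite inE.
have [bm|/uP[l bl]] := eqVneq b.2 ord_max.
  left; rewrite eq_sym; have := compatP _ _ cA _ _ aA bA.
  by rewrite /compat_rel jm /= bm eqxx orbT /= => /andP[].
have /uP[k bk] : b.1 != ord_max.
  have := strictP _ sA _ bA; apply: contraTneq => ->.
  by rewrite -leqNgt -ltnS ltn_ord.
right; apply/widen_arcsP; exists (k, l); rewrite ?inE -bk -bl; by case: (b) bA.
Qed.

(** If the last point is open, deleting it leaves [h - 1] open points, which is impossible for
    [h = 0]. If it is a closer, deleting its arc costs a factor [x] and reopens its partner, giving
    [h + 1]. *)
Lemma open_sumS (h : nat) : open_sum n.+1 h =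
  (if h is h'.+1 then open_sum n h' else 0) + x * open_sum n h.+1.
Proof.
rewrite {1}/open_sum (bigID (fun A : {set 'I_n.+1 * 'I_n.+1} => ord_max \in endpoints A)).
rewrite [LHS]addrC /=; congr (_ + _).
  transitivity (\sum_(A : {set 'I_n.+1 * 'I_n.+1} |
      (A \subset codom (fun a : 'I_n * 'I_n => (u a.1, u a.2))) &&
      (open_matching h A && (ord_max \notin endpoints A))) x ^+ #|A|).
    apply: eq_bigl => A; rewrite [RHS]andb_idl // => /andP[_ mA].
    have out i : i \in endpoints A -> i != ord_max by apply: contraTneq => ->.
    apply/subsetP=> -[i j] aA; apply/codomP.
    have /out/uP[k ->] : i \in endpoints A by apply/endpointsP; exists (i, j); rewrite ?eqxx.
    have /out/uP[l ->] : j \in endpoints A by apply/endpointsP; exists (i, j); rewrite ?eqxx ?orbT.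
    by exists (k, l).
  have upI : injective (fun a : 'I_n * 'I_n => (u a.1, u a.2)).
    by move=> [i j] [k l] [/val_inj-> /val_inj->].
  rewrite sum_imset //.
  transitivity (\sum_(B : {set 'I_n * 'I_n} | (0 < h)%N && open_matching h.-1 B) x ^+ #|B|).
    apply: eq_big => [B|B _]; last by rewrite card_imset.
    by rewrite -/(widen_arcs B) open_matching_widen endpoints_widen max_notin_u andbT.
  by case: h => [|h] //=; rewrite big_pred0.
rewrite /open_sum big_distrr /=.
(* The deleted arc is recovered from the rest, since it must start at the top open point. *)
rewrite (reindex_onto (fun B => add_arc (top B) B) restrict_arcs) /=; last first.
  move=> A /andP[oA mA]; case/and4P: (oA) => sA cA _ _.
  have [t E] := restrict_arcsK sA cA mA; rewrite -E in oA.
  move: oA; rewrite open_matching_add => /andP[_ /topE].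
  by move=> ->.
apply: eq_big => [B|B _]; last by rewrite card_add_arc exprS.
rewrite add_arcK eqxx andbT; apply/andP/idP=> [[oB mB]|oB].
  have /uP[t tE] : top B != ord_max.
    case/and4P: oB => /strictP sB _ _ _; have := sB (top B, ord_max).
    by rewrite setU11 => /(_ isT) /=; apply: contraTneq => ->; rewrite ltnn.
  by move: oB; rewrite tE open_matching_add => /andP[].
have /ex_top[t tB] : (0 < #|~: endpoints B|)%N by case/and4P: oB => _ _ _ /eqP->.
by rewrite (topE tB) open_matching_add oB tB endpoints_add setU11.
Qed.

End Peel.

(** * Ballot numbers and Catalan numbers *)

Section Ballot.
Variables (R : comPzRingType) (x : R).

Lemma open_sum0 h : open_sum x 0 h = (h == 0%N)%:R.
Proof.
rewrite /open_sum (eq_bigl (fun A : {set 'I_0 * 'I_0} => (A == set0) && (h == 0%N))) => [|A].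
  case: (h == 0%N); last by rewrite big_pred0 // => A; rewrite andbF.
  by rewrite (big_pred1 set0) ?cards0 // => A; rewrite andbT.
have -> : A = set0 by apply/setP=> -[[]].
rewrite eqxx /open_matching eq_sym; have -> : ~: endpoints (set0 : {set 'I_0 * 'I_0}) = set0.
  by apply/setP=> -[].
rewrite cards0; have -> : strict (set0 : {set 'I_0 * 'I_0}) by apply/strictP=> -[[]].
have -> : compat true (set0 : {set 'I_0 * 'I_0}) by apply/compatP=> -[[]].
by have -> : exposed (set0 : {set 'I_0 * 'I_0}) by apply/exposedP=> -[[]].
Qed.

(* Reflection principle: ballot m h counts the words with m closers and m + h
   openers in which no closer precedes its opener. *)
Definition ballot m h : R :=
  'C(m.*2 + h, m + h)%:R - 'C(m.*2 + h, (m + h).+1)%:R.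

(** By Pascal's rule the ballot numbers satisfy the recurrence [open_sumS]. The second clause covers
    heights [h] of the wrong parity or above [n]. *)
Lemma open_sum_ballot n h :
  (forall m, n = (m.*2 + h)%N -> open_sum x n h = ballot m h * x ^+ m) /\
  ((forall m, n <> (m.*2 + h)%N) -> open_sum x n h = 0).
Proof.
elim: n h => [|n IH] h.
  rewrite open_sum0; split=> [m E|H]; last by case: h H => // /(_ 0%N).
  have [-> ->] : m = 0%N /\ h = 0%N by lia.
  by rewrite /ballot bin0 bin_small // subr0 mulr1.
rewrite open_sumS; split=> [m E|H]; last first.
  have [_ ->] := IH h.+1; last by move=> m E; apply: (H m.+1); lia.
  case: h H => [|h] H; first by rewrite mulr0 addr0.
  have [_ ->] := IH h; last by move=> m E; apply: (H m); lia.
  by rewrite mulr0 addr0.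
(* For [m = 0] every point is open, and the closing term vanishes because height [n + 2] cannot be
   reached with [n] points. *)
case: m E => [|m] E.
  have -> : h = n.+1 by lia.
  have [_ ->] := IH n.+2; last by lia.
  have [/(_ 0%N erefl) -> _] := IH n.
  by rewrite /ballot !add0n !binn !bin_small // mulr0 addr0.
have [IHm _] := IH h.+1; rewrite (IHm m); last by lia.
rewrite mulrCA -exprS; case: h {IHm} E => [|h] E.
  rewrite add0r /ballot; congr (_ * _); rewrite !addn0 addn1 doubleS !addn1.
  rewrite !binS.
  (* At height 0 the first summand is missing; the recurrence still holds because the two middle
     coefficients of row [2m + 1] agree. *)
  have -> : 'C(m.*2.+1, m) = 'C(m.*2.+1, m.+1).
    by rewrite -bin_sub; [congr 'C(_, _)|]; lia.
  rewrite !natrD; ring.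
have [IHm _] := IH h; rewrite (IHm m.+1); last by lia.
rewrite -mulrDl; congr (_ * _); rewrite /ballot.
rewrite doubleS !addnS !addSn !binS !natrD; ring.
Qed.

(** From [E], [m + 1] times the difference of the two binomials is ['C(m.*2, m)], so the division in
    [catalan] is exact. *)
Lemma ballot_catalan m : ballot m 0 = (catalan m)%:R.
Proof.
rewrite /ballot !addn0 /catalan.
have E := mul_bin_left m.*2 m; have {}E : (m.+1 * 'C(m.*2, m.+1) = m * 'C(m.*2, m))%N.
  by rewrite E; congr muln; lia.
have le : ('C(m.*2, m.+1) <= 'C(m.*2, m))%N.
  by rewrite -(@leq_pmul2l m.+1) // E leq_mul2r leqnSn orbT.
rewrite -natrB //; congr _%:R.
rewrite -[X in _ = (X %/ _)%N](_ : m.+1 * ('C(m.*2, m) - 'C(m.*2, m.+1)) = _)%N.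
  by rewrite mulKn.
by rewrite mulnBr E; lia.
Qed.

(** Full arc sets are the open matchings of height 0, for which [exposed] holds vacuously. *)
Lemma arc_sum_matching n :
  arc_sum x true true n = if odd n then 0 else (catalan n./2)%:R * x ^+ n./2.
Proof.
transitivity (open_sum x n 0).
  apply: eq_bigl => A; rewrite /open_matching; congr [&& _, _ & _].
  rewrite cards_eq0 -setCT (inj_eq (@setC_inj _)) /=; case: eqVneq => //= AT; rewrite ?andbF // andbT.
  by apply/esym/exposedP => a j _; rewrite AT inE.
have [E O] := open_sum_ballot n 0; case: ifP => on.
  by apply: O => m En; move: on; rewrite En addn0 odd_double.
by rewrite (E n./2) ?ballot_catalan // addn0 even_halfK // on.
Qed.

End Ballot.

(** * Derivation of the four formulas from the arc sums *)

Lemma sum_even (V : nmodType) n (F : nat -> V) :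
  (forall k, odd k -> F k = 0) ->
  \sum_(0 <= k < n.+1) F k = \sum_(0 <= k < (n./2).+1) F k.*2.
Proof.
move=> F0; elim: n => [|n IH]; first by rewrite !big_nat1.
rewrite big_nat_recr //= IH uphalf_half; have [on|on] := boolP (odd n).
  rewrite add1n [RHS]big_nat_recr //=; congr (_ + F _).
  by rewrite doubleS odd_halfK //; case: n on {IH}.
by rewrite F0 ?addr0.
Qed.

Theorem theorem3p4 (R : comPzRingType) (n : nat) (x y : R) :
  (Bxy n.+1 x y = \sum_(0 <= k < n.+1) 'C(n, k)%:R * Bx k x * y ^+ (n - k)
   /\ Bxy n.+1 x y = \sum_(0 <= k < n.+1) 'C(n, k)%:R * Fe k x * (y + 1) ^+ (n - k))
  /\
  (Cxy n.+1 x y = \sum_(0 <= k < n.+1) 'C(n, k)%:R * Mo k x * y ^+ (n - k)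
   /\ Cxy n.+1 x y = \sum_(0 <= k < (n./2).+1)
        (catalan k)%:R * 'C(n, k.*2)%:R * x ^+ k * (y + 1) ^+ (n - k.*2)).
Proof.
(* Expanding strict sets through full ones passes from powers of [y] to powers of [y + 1], for both
   values of [c] at once. *)
have full c : \sum_(0 <= k < n.+1) 'C(n, k)%:R * arc_sum x c false k * y ^+ (n - k) =
    \sum_(0 <= k < n.+1) 'C(n, k)%:R * arc_sum x c true k * (y + 1) ^+ (n - k).
  rewrite -sum_binomial2; apply: eq_bigr => k _; by rewrite arc_sum_endpoints.
have BE : Bxy n.+1 x y =
    \sum_(0 <= k < n.+1) 'C(n, k)%:R * arc_sum x false false k * y ^+ (n - k).
  rewrite -sum_weak -sum_shift; apply: eq_bigl => P; by rewrite andbT.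
have CE : Cxy n.+1 x y =
    \sum_(0 <= k < n.+1) 'C(n, k)%:R * arc_sum x true false k * y ^+ (n - k).
  by rewrite -sum_weak -sum_shift.
split; split.
- by rewrite BE; apply: eq_bigr => k _; rewrite Bx_arc_sum.
- by rewrite BE full; apply: eq_bigr => k _; rewrite Fe_arc_sum.
- by rewrite CE; apply: eq_bigr => k _; rewrite Mo_arc_sum.
(* Perfect matchings need an even number of points, so only the even indices survive. *)
rewrite CE full sum_even => [|k ok]; last by rewrite arc_sum_matching ok mulr0 mul0r.
apply: eq_bigr => k _; rewrite arc_sum_matching odd_double doubleK.
by rewrite mulrA [in LHS](mulrC 'C(_, _)%:R).
Qed.
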